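(* Let $d\ge1$, $k=d$ and $\alpha=\infty$, let $E$ be the edge set of $\mathbb Z^d$, and let $\mathcal E_\infty$ be the set of eventually always reinforced edges of the $\alpha=\infty$ reinforced $d$-out process on $\mathbb Z^d$. Then the random set $\mathcal E_\infty$ stochastically dominates the random set $E\setminus\mathcal E_\infty$.
   Context: Reinforced $k$-out process with $\alpha=\infty$ on $\mathbb Z^d$. Let $E$ be the set of nearest-neighbour edges of $\mathbb Z^d$. Each edge $e\in E$ carries a weight $W_e(t)$, $t=0,1,2,\dots$, with $W_e(0)=1$. In each round $t\ge1$, simultaneously for all sites $z\in\mathbb Z^d$, the $2d$ edges incident to $z$ are ordered decreasingly by their current weights $W_e(t-1)$, ties being broken uniformly at random, independently over sites and rounds; $z$ selects the first $k$ edges in this order. Then $W_e(t)-W_e(t-1)\in\{0,1,2\}$ is the number of endpoints of $e$ that selected $e$ in round $t$. Define $$\mathcal E_\infty:=\{e\in E:\ \liminf_{t\to\infty}(W_e(t)-W_e(t-1))\ge1\}.$$ A random subset $A$ of $E$ stochastically dominates a random subset $B$ of $E$ if there is a coupling $(A',B')$ of $A$ and $B$ with $B'\subseteq A'$ almost surely. *)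

(* Defs.v *)
From HB Require Import structures.
From mathcomp Require Import all_boot all_order all_algebra perm.
From mathcomp Require Import finmap.
From mathcomp Require Import all_classical all_reals all_analysis.

Set Implicit Arguments.
Unset Strict Implicit.
Unset Printing Implicit Defensive.

Import Order.TTheory GRing.Theory Num.Theory.

Local Open Scope classical_set_scope.
Local Open Scope ring_scope.

Definition site (d : nat) := 'rV[int]_d.

(* (x, i) stands for the undirected edge {x, x + e_i}; every nearest-neighbour
   edge of Z^d is represented by exactly one such pair. *)
Definition edge (d : nat) := (site d * 'I_d)%type.

Definition edge_tail d (e : edge d) : site d := e.1.
Definition edge_head d (e : edge d) : site d := e.1 + delta_mx 0 e.2.

(* (i, true) is the direction +e_i and (i, false) the direction -e_i. *)
Definition direction (d : nat) := ('I_d * bool)%type.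

Definition incident d (z : site d) (a : direction d) : edge d :=
  if a.2 then (z, a.1) else (z - delta_mx 0 a.1, a.1).

(* The 2d edges at z, listed in the order given by the permutation s and then
   sorted by decreasing weight.  As [sort] is stable, s decides the ties: for a
   uniformly random s, all ties are broken uniformly at random. *)
Definition ranking d (W : edge d -> nat) (s : {perm direction d}) (z : site d) :
    seq (edge d) :=
  sort (fun e f => (W f <= W e)%N) [seq incident z (s a) | a : direction d].

Definition selects d (k : nat) (W : edge d -> nat) (s : {perm direction d})
    (z : site d) (e : edge d) : bool :=
  e \in take k (ranking W s z).

(* [s t z] is the permutation breaking the ties at z in round t + 1. *)
Fixpoint weight d (k : nat) (s : nat -> site d -> {perm direction d}) (t : nat) :
    edge d -> nat :=
  if t is t'.+1 then
    let W := weight k s t' in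
    fun e => (W e + selects k W (s t' (edge_tail e)) (edge_tail e) e
                  + selects k W (s t' (edge_head e)) (edge_head e) e)%N
  else fun=> 1%N.

Definition always_reinforced (R : realType) d (k : nat)
    (s : nat -> site d -> {perm direction d}) : set (edge d) :=
  [set e | (1 <= limn_einf (fun t : nat =>
     ((weight k s t.+1 e)%:R - (weight k s t e)%:R : R)%:E))%E].

Section Probability.
Context (dT : measure_display) (T : measurableType dT) (R : realType).
Variable P : probability T R.

(* F carries the discrete sigma-algebra: every B i is an event. *)
Definition mutually_independent (I : choiceType) (F : finType)
    (X : I -> T -> F) : Prop :=
  forall (J : {fset I}) (B : I -> set F),
    P (\bigcap_(i in [set` J]) X i @^-1` B i) =
    (\prod_(i <- J) P (X i @^-1` B i))%E.

Definition uniformly_distributed (F : finType) (X : T -> F) : Prop :=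
  forall a : F, measurable (X @^-1` [set a]) /\
    P (X @^-1` [set a]) = (#|F|%:R^-1)%:E.

Definition tie_breaking d (s : nat -> site d -> T -> {perm direction d}) : Prop :=
  (forall t z, uniformly_distributed (s t z)) /\
  mutually_independent (fun tz : nat * site d => s tz.1 tz.2).

End Probability.

(* The product sigma-algebra on {0,1}^E, seen as the set of subsets of E. *)
Definition coordinate_events (E : Type) : set (set (set E)) :=
  [set C | exists e : E, C = [set S : set E | S e]].

Definition subset_space (E : Type) := g_sigma_algebraType (@coordinate_events E).

Definition random_subset dT (T : measurableType dT) (E : Type) (A : T -> set E) :=
  measurable_fun setT (A : T -> subset_space E).

Definition same_law dT (T : measurableType dT) dT' (T' : measurableType dT')
    (R : realType) (P : probability T R) (P' : probability T' R) (E : Type)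
    (A : T -> set E) (A' : T' -> set E) : Prop :=
  forall C : set (subset_space E), measurable C ->
    P (A @^-1` C) = P' (A' @^-1` C).

Definition stochastically_dominates dT (T : measurableType dT) (R : realType)
    (P : probability T R) (E : Type) (A B : T -> set E) : Prop :=
  [/\ random_subset A, random_subset B &
    exists (dQ : measure_display) (U : measurableType dQ) (Q : probability U R)
           (A' B' : U -> set E),
      [/\ random_subset A', random_subset B',
          same_law P Q A A', same_law P Q B B' &
          {ae Q, forall u, B' u `<=` A' u}]].

(* Main.v *)
(* Reverse the order in which every site breaks its ties.  As k = d is half
   the degree, this exchanges "selected" and "not selected" at each end of each
   edge, so an increment i becomes 2 - i in every round: the two weights of an
   edge add up to 2t + 2 at time t, all rankings are reversed, and the symmetry
   persists.  The reversed permutations have the same joint law as the original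
   ones, hence the complement of E_infty is distributed as the complement of
   the reversed E_infty, that is, as the set of edges that get increment 2
   infinitely often in the original process; and this set is contained in
   E_infty, because an edge selected by both ends once is selected by both ends
   forever. *)
Require Import Defs.
From HB Require Import structures.
From mathcomp Require Import all_boot all_order all_algebra perm.
From mathcomp Require Import finmap zify.
From mathcomp Require Import all_classical all_reals all_analysis.

Set Implicit Arguments.
Unset Strict Implicit.
Unset Printing Implicit Defensive.

Import Order.TTheory GRing.Theory Num.Theory.

Local Open Scope classical_set_scope.

(** * Stable sorting and list reversal *)

(** Stability makes both sides sorted for one strict order, which compares by [leT] and then by
    position; a list sorted for a strict order is determined by its elements. *)
Lemma sort_rev (T : Type) (leT : rel T) (s : seq T) :
  total leT -> transitive leT ->
  sort (fun x y => leT y x) (rev s) = rev (sort leT s).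
Proof.
case: s => // x0 s0; set s := x0 :: s0; move=> tot tr.
(* Positions replace the entries: they are pairwise distinct even if [s] has repetitions. *)
rewrite -(mkseq_nth x0 s) /mkseq -map_rev !sort_map -map_rev; congr map.
set r := relpre (nth x0 s) leT; set n := size s.
have rtot : total r by move=> x y; exact: tot.
have rtr : transitive r by move=> y x z; exact: tr.
(* Decreasing for [r], with ties in decreasing order of position. *)
pose lex := [rel x y | r y x && (r x y ==> (y < x)%N)].
apply: (@irr_sorted_eq _ lex).
- move=> y x z /= /andP[ryx /implyP xy] /andP[rzy /implyP yz].
  apply/andP; split; first exact: rtr rzy ryx.
  apply/implyP => rxz.
  exact: ltn_trans (yz (rtr _ _ _ ryx rxz)) (xy (rtr _ _ _ rxz rzy)).
- by move=> x /=; rewrite ltnn implybF andbN.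
- apply: (@sort_stable _ (fun x y => r y x) (fun x y => (y < x)%N)).
  + by move=> x y; exact: rtot.
  + by move=> y x z /= yx zy; exact: ltn_trans yx.
  + by rewrite rev_sorted; exact: iota_ltn_sorted.
- rewrite rev_sorted.
  exact: (sort_stable rtot ltn_trans (iota_ltn_sorted 0 n)).
- by move=> x; rewrite mem_rev !mem_sort mem_rev.
Qed.

Section EnumReversal.
Variable T : finType.

Definition enum_rev (a : T) : T := nth a (rev (enum T)) (index a (enum T)).

Lemma map_enum_rev : map enum_rev (enum T) = rev (enum T).
Proof.
case: (pickP (mem T)) => [a _|T0]; last first.
  by rewrite (_ : enum T = [::]) //; apply/size0nil; rewrite -cardE eq_card0.
apply: (@eq_from_nth _ a) => [|i]; first by rewrite size_map size_rev.
rewrite size_map => ltiT; rewrite (nth_map a) // /enum_rev.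
by rewrite index_uniq ?enum_uniq //; apply: set_nth_default; rewrite size_rev.
Qed.

Lemma enum_rev_inj : injective enum_rev.
Proof.
apply/injectiveP; rewrite /injectiveb /dinjectiveb map_enum_rev.
by rewrite rev_uniq enum_uniq.
Qed.

Definition enum_rev_perm : {perm T} := perm enum_rev_inj.

(** A product of permutations applies its left factor first, so this factor reverses the order in
    which the arguments of [s] are listed, whatever [s] is. *)
Lemma image_enum_rev_perm (S : Type) (f : T -> S) (s : {perm T}) :
  [seq f ((enum_rev_perm * s)%g a) | a : T] = rev [seq f (s a) | a : T].
Proof.
rewrite /image_mem -map_rev -map_enum_rev -map_comp; apply: eq_map => a /=.
by rewrite permM permE.
Qed.

End EnumReversal.

(** * The selection made by one site *)

Section Selection.
Variable d : nat.
Implicit Types (W : edge d -> nat) (s : {perm direction d}) (z : site d).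

Lemma incident_inj z : injective (incident z).
Proof.
have delta0 (i : 'I_d) : (delta_mx 0%R i : site d) != 0%R.
  by apply/eqP => /matrixP/(_ 0%R i); rewrite !mxE !eqxx.
have subz (i : 'I_d) : (z - delta_mx 0%R i)%R <> z.
  by move/eqP; rewrite -subr_eq0 addrC addKr oppr_eq0 (negPf (delta0 i)).
case=> i [] [j []]; rewrite /incident /=.
- by case=> ->.
- by case=> /esym/subz.
- by case=> /subz.
- by case=> _ ->.
Qed.

Lemma mem_ranking W s z e : (e \in ranking W s z) = (e \in codom (incident z)).
Proof.
rewrite /ranking mem_sort; apply/idP/codomP => [/mapP[a _ ->]|[a ->]].
  by exists (s a).
by apply/mapP; exists ((s^-1)%g a); rewrite ?mem_enum // permKV.
Qed.

Lemma ranking_uniq W s z : uniq (ranking W s z).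
Proof.
rewrite sort_uniq; apply/(injectiveP (fun a => incident z (s a))) => a b.
by move/incident_inj/perm_inj.
Qed.

Lemma size_ranking W s z : size (ranking W s z) = d.*2.
Proof. by rewrite size_sort size_image card_prod card_ord card_bool muln2. Qed.

Lemma ranking_sorted W s z :
  sorted (fun e f => (W f <= W e)%N) (ranking W s z).
Proof. by apply: sort_sorted => e f; rewrite leq_total. Qed.

Lemma mem_codom_tail (e : edge d) : e \in codom (incident (edge_tail e)).
Proof. by apply/codomP; exists (e.2, true); case: e. Qed.

Lemma mem_codom_head (e : edge d) : e \in codom (incident (edge_head e)).
Proof.
apply/codomP; exists (e.2, false).
by case: e => x i; rewrite /incident /= addrK.
Qed.

Lemma incident_ends z e :
  e \in codom (incident z) -> z = edge_tail e \/ z = edge_head e.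
Proof.
move=> /codomP[[i []] ->]; rewrite /incident /edge_tail /edge_head /=.
  by left.
by right; rewrite subrK.
Qed.

Lemma ranking_opposite W W' c s z : (forall e, W e + W' e = c)%N ->
  ranking W' (enum_rev_perm _ * s)%g z = rev (ranking W s z).
Proof.
move=> WW'; rewrite /ranking image_enum_rev_perm.
rewrite (_ : (fun e f => _) = (fun e f => W e <= W f)%N); last first.
  by apply/funext => e; apply/funext => f; have := WW' e; have := WW' f; lia.
apply: (@sort_rev _ (fun e f => W f <= W e)%N) => [e f|f e g].
  by rewrite leq_total.
by move=> fe gf; exact: leq_trans gf fe.
Qed.

(** The ranking has 2d distinct entries, so the first d entries of its reversal are its last d
    entries, and each incident edge lies in exactly one half. *)
Lemma selects_opposite W W' c s z e : (forall e, W e + W' e = c)%N ->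
  e \in codom (incident z) ->
  selects d W' (enum_rev_perm _ * s)%g z e = ~~ selects d W s z e.
Proof.
move=> WW' ze; rewrite /selects (ranking_opposite _ _ WW') take_rev mem_rev.
rewrite size_ranking -addnn addnK.
have := ranking_uniq W s z; have := mem_ranking W s z e; rewrite ze.
rewrite -[X in _ \in X](cat_take_drop d) -[X in uniq X](cat_take_drop d).
rewrite mem_cat cat_uniq => /orP ecat /and3P[_ /hasPn disj _].
case: ecat => [et|ed]; last by rewrite ed (negPf (disj _ ed)).
by rewrite et /=; apply/negP => /disj /=; rewrite et.
Qed.

Lemma leq_selects k W s z e f : selects k W s z e ->
  f \in codom (incident z) -> ~~ selects k W s z f -> (W f <= W e)%N.
Proof.
rewrite /selects -(mem_ranking W s) => et.
rewrite -{1}[ranking W s z](cat_take_drop k) mem_cat => /orP[-> //|fd] _.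
have := ranking_sorted W s z; rewrite sorted_pairwise; last first.
  by move=> y x t xy yt; exact: leq_trans yt xy.
rewrite -{1}[ranking W s z](cat_take_drop k) pairwise_cat.
by case/and3P => /allrelP + _ _; apply.
Qed.

(** Counting: if [e] were dropped, every newly selected edge would weigh at least [W1 e], hence
    would be an old selected edge other than [e]; but both selections have the same size. *)
Lemma selects_again k W W1 s s1 z e : selects k W s z e ->
  (forall f, f \in codom (incident z) -> ~~ selects k W s z f ->
    W1 f < W1 e)%N ->
  selects k W1 s1 z e.
Proof.
move=> se lt_e; apply/negPn/negP => s1e.
have ze : e \in codom (incident z).
  by move: se; rewrite /selects => /mem_take; rewrite mem_ranking.
have sub : {subset take k (ranking W1 s1 z) <= rem e (take k (ranking W s z))}.
  move=> g s1g; rewrite mem_rem_uniq ?take_uniq ?ranking_uniq // inE.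
  apply/andP; split; first by apply: contraNneq s1e => <-.
  have := leq_selects s1g ze s1e; apply: contraTT => sg.
  rewrite -ltnNge; apply: lt_e => //.
  by rewrite -(mem_ranking W1 s1); exact: mem_take s1g.
have := uniq_leq_size (take_uniq _ (ranking_uniq _ _ _)) sub.
rewrite size_rem // !size_take !size_ranking.
have : (0 < size (take k (ranking W s z)))%N.
  by move: se; rewrite /selects; case: (take _ _).
by rewrite size_take size_ranking; case: ifP; lia.
Qed.

End Selection.

(** * The reversed process and persistence of double reinforcement *)

Section Dynamics.
Variable d : nat.
Implicit Types (s : nat -> site d -> {perm direction d}) (e : edge d).

Definition reversed_ties s : nat -> site d -> {perm direction d} :=
  fun t z => (enum_rev_perm _ * s t z)%g.

Lemma weight_reversed s t e :
  (weight d s t e + weight d (reversed_ties s) t e = t.+1.*2)%N.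
Proof.
elim: t e => [|t IH] e //=.
rewrite !(selects_opposite _ IH) ?mem_codom_tail ?mem_codom_head //.
have := IH e; do 2! case: (selects _ _ _ _ _) => /=; lia.
Qed.

Lemma twice_reinforced_succ k s t e :
  (weight k s t.+1 e = (weight k s t e).+2 ->
   weight k s t.+2 e = (weight k s t.+1 e).+2)%N.
Proof.
set W := weight k s t; set W1 := weight k s t.+1 => W1e.
(* At an end z of e, an edge not selected by z weighs at most as much as e and
   gains at most 1, while e gains 2; so e overtakes all such edges strictly. *)
suff again z : z = edge_tail e \/ z = edge_head e ->
    selects k W1 (s t.+1 z) z e.
  by rewrite [LHS]/= -/W1 !again; [rewrite !addn1|right|left].
move=> ze.
have sel : selects k W (s t z) z e.
  move: W1e; rewrite /W1 /= -/W; case: ze => ->;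
    by do 2! case: (selects _ _ _ _ _) => //=; lia.
apply: (selects_again _ sel) => f zf nsf.
have Wfe := leq_selects sel zf nsf.
have W1f : (W1 f <= (W f).+1)%N.
  rewrite /W1 /= -/W.
  have [zt|zh] := incident_ends zf.
    by rewrite -zt (negPf nsf); case: (selects _ _ _ _ _); lia.
  by rewrite -zh (negPf nsf); case: (selects _ _ _ _ _); lia.
by rewrite W1e ltnS (leq_trans W1f).
Qed.

Lemma twice_reinforced_forever k s t n e : (t <= n)%N ->
  (weight k s t.+1 e = (weight k s t e).+2)%N ->
  (weight k s n.+1 e = (weight k s n e).+2)%N.
Proof.
move=> /subnK <-; elim: (n - t)%N => [//|m IH] te.
exact: twice_reinforced_succ (IH te).
Qed.

(** The liminf is the supremum over [N] of the infima over the rounds from [N] on, and the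
    increments are natural numbers. *)
Lemma always_reinforcedE (R : realType) k s e :
  always_reinforced R k s e <->
  exists N, forall n, (N <= n)%N -> (weight k s n e < weight k s n.+1 e)%N.
Proof.
rewrite /always_reinforced /= limn_einf_lim.
rewrite (cvg_lim _ (@cvg_einfs_sup _ _)) //; split=> [le1|[N lt_e]].
  (* If every tail contains a round without increase, all tail infima are at most 0. *)
  apply: contrapT => /forallNP noN; move: le1; apply/negP; rewrite -ltNge.
  apply: (@le_lt_trans _ _ 0%E); last by rewrite lte_fin.
  apply: ge_ereal_sup => _ [N _ <-] /=.
  have /existsNP[n /not_implyP[Nn /negP]] := noN N; rewrite -leqNgt => ge_e.
  apply: (le_trans (ereal_inf_lbound _)); first by exists n.
  by rewrite lee_fin subr_le0 ler_nat.
apply: (le_trans _ (ereal_sup_ubound _)); last by exists N.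
apply: le_ereal_inf_tmp => _ [n /= Nn <-].
by rewrite lee_fin lerBrDl natr1 ler_nat; exact: lt_e.
Qed.

Lemma always_reinforced_reversed (R : realType) s e :
  ~ always_reinforced R d (reversed_ties s) e -> always_reinforced R d s e.
Proof.
move=> notr; apply/always_reinforcedE.
(* A single round in which [e] gains 0 in the reversed process is enough: it gains 2 in the original
   one. *)
have /existsNP[t noinc] : ~ forall t,
    (weight d (reversed_ties s) t e < weight d (reversed_ties s) t.+1 e)%N.
  by move=> inc; apply: notr; apply/always_reinforcedE; exists 0%N.
have twice : (weight d s t.+1 e = (weight d s t e).+2)%N.
  have := weight_reversed s t e; have := weight_reversed s t.+1 e.
  move: noinc => /=; do 4! case: (selects _ _ _ _ _) => //=; lia.
by exists t => n tn; rewrite (twice_reinforced_forever tn twice).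
Qed.

End Dynamics.

(** * Measurability of variables with discrete values *)

Section DiscreteMeasurability.
Context dT (T : measurableType dT).

Definition discretely_measurable (C : Type) (X : T -> C) : Prop :=
  forall B : set C, measurable (X @^-1` B).

Lemma discretely_measurable_fibers (C : countType) (X : T -> C) :
  (forall c, measurable (X @^-1` [set c])) -> discretely_measurable X.
Proof.
move=> mX B.
(* The inner set is {c} if c is in [B] and empty otherwise, so the union can run over the whole
   countable type. *)
rewrite (_ : _ @^-1` B = \bigcup_c (X @^-1` [set c' | c' = c /\ B c])).
  apply: countable_bigcupT_measurable => [|c]; first exact: countableP.
  have [Bc|nBc] := pselect (B c).
    rewrite (_ : [set c' | _] = [set c]) //.
    by apply/seteqP; split => c' /=; [case|].
  rewrite (_ : X @^-1` _ = set0) //.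
  by apply/seteqP; split => w //= [].
by apply/seteqP; split=> [w Bw|w [c _ [<-]]] //; exists (X w).
Qed.

Lemma discretely_measurable_comp (C D : Type) (g : C -> D) (X : T -> C) :
  discretely_measurable X -> discretely_measurable (fun w => g (X w)).
Proof. by move=> mX B; exact: (mX (g @^-1` B)). Qed.

Lemma discretely_measurable_pair (C D : countType) (X : T -> C) (Y : T -> D) :
  discretely_measurable X -> discretely_measurable Y ->
  discretely_measurable (fun w => (X w, Y w)).
Proof.
move=> mX mY; apply: discretely_measurable_fibers => -[c c'].
rewrite (_ : _ @^-1` _ = X @^-1` [set c] `&` Y @^-1` [set c']).
  exact: measurableI.
by apply/seteqP; split => w /= [] => [-> ->|-> ->].
Qed.

Lemma discretely_measurable_ffun (J : finType) (C : countType)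
    (X : J -> T -> C) :
  (forall j, discretely_measurable (X j)) ->
  discretely_measurable (fun w => [ffun j => X j w]).
Proof.
move=> mX; apply: discretely_measurable_fibers => f.
rewrite (_ : _ @^-1` _ = \bigcap_(j in [set: J]) X j @^-1` [set f j]).
  by apply: fin_bigcap_measurable => // j _; exact: mX.
apply/seteqP; split => w /= => [<- j _|Xf] /=; first by rewrite ffunE.
by apply/ffunP => j; rewrite ffunE; exact: Xf.
Qed.

Lemma discretely_measurable_uniform (R : realType) (P : probability T R)
    (F : finType) (X : T -> F) :
  uniformly_distributed P X -> discretely_measurable X.
Proof.
by move=> uX; apply: discretely_measurable_fibers => c; case: (uX c).
Qed.

Lemma random_subset_coordinates (E : Type) (A : T -> set E) :
  (forall e, measurable [set w | A w e]) -> random_subset A.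
Proof.
move=> mA; apply: (@measurability _ _ T (subset_space E) setT A
  (@coordinate_events E)) => // _ [_ [e ->] <-].
by rewrite setTI; exact: mA.
Qed.

End DiscreteMeasurability.

(* [g_sigma_algebraType] is a measurableType only over a pointed type. *)
HB.instance Definition _ (D : finType) :=
  isPointed.Build (perm_type D) (perm_one D).

(** * The product space of tie-breaking permutations *)

Section Configurations.
Variables (I : choiceType) (D : finType).

Definition cylinders : set (set (I -> {perm D})) :=
  [set C | exists (J : {fset I}) (B : I -> set {perm D}),
     C = \bigcap_(i in [set` J]) [set w | B i (w i)]].

Definition configuration := g_sigma_algebraType cylinders.

Lemma cylinders_setI : setI_closed cylinders.
Proof.
move=> _ _ [J [B ->]] [J' [B' ->]].
exists (J `|` J')%fset,
  (* [B] and [B'] are arbitrary outside [J] and [J'], so each constraint is imposed only on its own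
     index set. *)
  (fun i => [set a | (i \in J -> B i a) /\ (i \in J' -> B' i a)]).
apply/seteqP; split=> [w [JB JB'] i /= _|w JJ'].
  by split=> ?; [exact: JB|exact: JB'].
by split=> i /= iJ; have := JJ' i; rewrite /= inE iJ ?orbT => /(_ isT)[]; auto.
Qed.

Lemma discretely_measurable_coordinate (i : I) :
  discretely_measurable (fun w : configuration => w i).
Proof.
move=> B; apply: sub_gen_smallest; exists [fset i]%fset, (fun=> B).
apply/seteqP; split=> [w Bw j /=|w /(_ i)]; first by rewrite inE => /eqP ->.
by rewrite /= inE eqxx; exact.
Qed.

Context dT (T : measurableType dT) (R : realType) (P : probability T R).

Definition joint (X : I -> T -> {perm D}) : T -> configuration :=
  fun w i => X i w.

Lemma measurable_joint (X : I -> T -> {perm D}) :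
  (forall i, discretely_measurable (X i)) -> measurable_fun setT (joint X).
Proof.
move=> mX; apply: (@measurability _ _ T configuration setT (joint X)
  cylinders) => // _ [_ [J [B ->]] <-].
rewrite setTI preimage_bigcap; apply: fin_bigcap_measurable => // i _.
exact: mX.
Qed.

(** By independence both laws give a cylinder the same product of marginals; cylinders form a
    generating pi-system, so the laws coincide. *)
Lemma joint_law_eq (X Y : I -> T -> {perm D}) :
  (forall i, discretely_measurable (X i)) ->
  (forall i, discretely_measurable (Y i)) ->
  mutually_independent P X -> mutually_independent P Y ->
  (forall i B, P (X i @^-1` B) = P (Y i @^-1` B)) ->
  forall C : set configuration, measurable C ->
    P (joint X @^-1` C) = P (joint Y @^-1` C).
Proof.
move=> /measurable_joint mX /measurable_joint mY iX iY XY C mC.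
pose mf Z mZ : {mfun T >-> configuration} :=
  HB.pack (joint Z) (isMeasurableFun.Build _ _ _ _ (joint Z) mZ).
rewrite -[LHS]/(distribution P (mf X mX) C) -[RHS]/(distribution P (mf Y mY) C).
apply: (@measure_unique _ R configuration cylinders (fun=> setT) _ _ _ _
  (distribution P (mf X mX)) (distribution P (mf Y mY))) => //.
- exact: cylinders_setI.
(* The whole space is the cylinder over no coordinates. *)
- by move=> _; exists fset0, (fun=> setT); apply/seteqP; split.
- by rewrite bigcup_const.
- move=> _ [J [B ->]].
  rewrite -[LHS]/(P (joint X @^-1` _)) -[RHS]/(P (joint Y @^-1` _)).
  rewrite !preimage_bigcap.
  by rewrite [LHS]iX [RHS]iY; apply: eq_bigr => i _; exact: XY.
- move=> _; rewrite -[ltLHS]/(P (joint X @^-1` setT)).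
  by rewrite preimage_setT probability_setT ltry.
Qed.

End Configurations.

(** * Invariance of the uniform law *)

Section UniformPermutations.
Context dT (T : measurableType dT) (R : realType) (P : probability T R).

(** An injection of a finite type is a bijection, and it reindexes a sum of equal point masses. *)
Lemma uniform_bij (F : finType) (X : T -> F) (h : F -> F) (B : set F) :
  injective h -> uniformly_distributed P X ->
  P (X @^-1` (h @^-1` B)) = P (X @^-1` B).
Proof.
move=> hI uX.
have PX (A : set F) :
    P (X @^-1` A) = (\big[+%E/0]_(a \in A) P (X @^-1` [set a]))%E.
  rewrite -measure_fin_bigcup //.
  - congr (P _); apply/seteqP; split=> [w Aw|w [a Aa /= ->]] //.
    by exists (X w).
  - exact: finite_finset.
  - by move=> a b _ _ [w [<- <-]].
  - by move=> a _; case: (uX a).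
rewrite !PX (@reindex_fsbig _ _ _ _ _ h (h @^-1` B) B).
  apply: eq_fsbigr => a _ /=.
  by case: (uX a) => _ ->; case: (uX (h a)) => _ ->.
split=> //; first by move=> a b _ _ /hI.
by move=> b Bb; exists (invF hI b); rewrite /= f_invF.
Qed.

End UniformPermutations.

(** * Measurability of the process *)

Section ProcessMeasurability.
Context (d : nat) dT (T : measurableType dT).
Variables (k : nat) (s : T -> nat -> site d -> {perm direction d}).
Hypothesis ms : forall t z, discretely_measurable (fun w => s w t z).

(** Only the 2d weights around [z] matter; as a finite function they range over a countable type,
    unlike the full weight field. *)
Lemma selects_ffun (W : edge d -> nat) (p : {perm direction d}) z e :
  selects k W p z e =
  (e \in take k (map (incident z)
    (sort (fun a b => [ffun c => W (incident z c)] b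
                      <= [ffun c => W (incident z c)] a)
      (map p (enum {: direction d}))))%N).
Proof.
rewrite /selects /ranking /image_mem map_comp sort_map.
congr (_ \in take k (map _ (sort _ _))).
by apply/funext => a; apply/funext => b /=; rewrite !ffunE.
Qed.

Lemma measurable_selects (W : T -> edge d -> nat) t z e :
  (forall f, discretely_measurable (fun w => W w f)) ->
  discretely_measurable (fun w => selects k (W w) (s w t z) z e).
Proof.
move=> mW.
pose local (p : {ffun direction d -> nat} * {perm direction d}) :=
  e \in take k (map (incident z)
    (sort (fun a b => p.1 b <= p.1 a)%N (map p.2 (enum {: direction d})))).
rewrite (_ : (fun w => _) = (fun w =>
    local ([ffun a => W w (incident z a)], s w t z))); last first.
  by apply/funext => w; rewrite selects_ffun.
apply: discretely_measurable_comp.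
apply: discretely_measurable_pair (ms t z).
by apply: discretely_measurable_ffun => a; exact: mW.
Qed.

Lemma measurable_weight t e :
  discretely_measurable (fun w => weight k (s w) t e).
Proof.
elim: t e => [|t IH] e; first by move=> B; rewrite preimage_cst; case: ifP.
have msel z := measurable_selects t z e IH.
pose add (p : nat * (bool * bool)) : nat := (p.1 + p.2.1 + p.2.2)%N.
apply: (@discretely_measurable_comp _ _ _ _ add
  (fun w => (weight k (s w) t e,
    (selects k (weight k (s w) t) (s w t (edge_tail e)) (edge_tail e) e,
     selects k (weight k (s w) t) (s w t (edge_head e)) (edge_head e) e)))).
apply: discretely_measurable_pair (IH e) _.
exact: discretely_measurable_pair.
Qed.

Lemma measurable_always_reinforced (R : realType) e :
  measurable [set w | always_reinforced R k (s w) e].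
Proof.
pose inc w n := (weight k (s w) n e < weight k (s w) n.+1 e)%N.
rewrite (_ : [set w | _] =
    \bigcup_N \bigcap_(n in [set n | (N <= n)%N]) [set w | inc w n]).
  apply: bigcupT_measurable => N; apply: bigcap_measurableType => n _.
  exact: (discretely_measurable_pair (measurable_weight n e)
    (measurable_weight n.+1 e) (fun p => p.1 < p.2)%N).
apply/seteqP; split=> [w /= /always_reinforcedE[N]|w [N _ incN]].
  by exists N.
by apply/always_reinforcedE; exists N.
Qed.

End ProcessMeasurability.

(** * The coupling *)

Theorem proposition7 (d : nat) (hd : (1 <= d)%N) (R : realType)
    (dT : measure_display) (T : measurableType dT) (P : probability T R)
    (s : nat -> site d -> T -> {perm direction d}) (hs : tie_breaking P s) :
  let E_infty (w : T) : set (edge d) :=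
    always_reinforced R d (fun t z => s t z w) in
  stochastically_dominates P E_infty (fun w => ~` E_infty w).
Proof.
case: hs => us is_ E_infty.
pose rev_perm (p : {perm direction d}) := (enum_rev_perm _ * p)%g.
pose rev_s (tz : nat * site d) w := rev_perm (s tz.1 tz.2 w).
pose rev_E w : set (edge d) :=
  always_reinforced R d (reversed_ties (fun t z => s t z w)).
have ms t z : discretely_measurable (s t z).
  exact: discretely_measurable_uniform (us t z).
have mrev tz : discretely_measurable (rev_s tz).
  exact: discretely_measurable_comp (ms _ _).
have rE tz B : P (rev_s tz @^-1` B) = P (s tz.1 tz.2 @^-1` B).
  exact: (@uniform_bij _ _ _ P _ (s tz.1 tz.2) rev_perm B (mulgI _) (us _ _)).
have irev : mutually_independent P rev_s.
  (* An event about a reversed permutation is an event about the original one. *)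
  by move=> J B; exact: (is_ J (fun tz => rev_perm @^-1` B tz)).
have mE : random_subset E_infty.
  by apply: random_subset_coordinates => e; exact: measurable_always_reinforced.
have mCE : random_subset (fun w => ~` E_infty w).
  apply: random_subset_coordinates => e; apply: measurableC.
  exact: measurable_always_reinforced.
have mrevE : random_subset (fun w => ~` rev_E w).
  apply: random_subset_coordinates => e; apply: measurableC.
  by apply: measurable_always_reinforced => t z; exact: (mrev (t, z)).
(* The coupling lives on the original space: [E_infty] is kept, and its complement is replaced by
   that of the reversed process. *)
split=> //; exists dT, T, P, E_infty, (fun w => ~` rev_E w); split=> //.
- move=> C mC.
  (* Both complements are the image under [Phi] of a tie-breaking field, the original or the
     reversed one, and these fields have the same law. *)
  pose Phi (w : configuration (nat * site d)%type (direction d)) :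
    set (edge d) := ~` always_reinforced R d (fun t z => w (t, z)).
  have mPhi : random_subset Phi.
    apply: random_subset_coordinates => e; apply: measurableC.
    apply: measurable_always_reinforced => t z.
    exact: discretely_measurable_coordinate.
  have mPhiC : measurable (Phi @^-1` C).
    by rewrite -[X in measurable X]setTI; exact: mPhi.
  exact: (joint_law_eq (fun tz => ms tz.1 tz.2) mrev is_ irev
    (fun tz B => esym (rE tz B)) mPhiC).
- by apply: aeW => w e; exact: always_reinforced_reversed.
Qed.
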